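(* Every infinite group is unstable. That is, for every infinite group $G$ there exists a non-empty subset $A\subseteq G$ such that $|G:A|^-\neq |G:A|^+$.
   Context: Let $G$ be a group with identity $e$ and let $A\subseteq G$ be a non-empty subset. A non-empty subset $U\subseteq G$ is called a right $s$-factor of $G$ associated with $A$ if (SF1) every element $x\in AU=\{au\mid a\in A,\ u\in U\}$ can be written uniquely as $x=au$ with $a\in A$ and $u\in U$ (i.e. the product $AU$ is direct), and (SF2) $U$ is maximal with respect to inclusion among subsets with this property. Let $\mathrm{SubF}_r(G:A)$ be the set of all right $s$-factors of $G$ associated with $A$ (it is non-empty by Zorn's lemma). Define the cardinals $|G:A|^-=\inf\{|U| \mid U\in \mathrm{SubF}_r(G:A)\}$ and $|G:A|^+=\sup\{|U| \mid U\in \mathrm{SubF}_r(G:A)\}$. The subset $A$ is called stable if $|G:A|^-=|G:A|^+$. The group $G$ is called stable if every non-empty subset of $G$ is stable, and unstable otherwise. *)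

(* Defs.v *)
From mathcomp Require Import all_boot.
From mathcomp Require Import boolp classical_sets functions cardinality.

Set Implicit Arguments.
Unset Strict Implicit.
Unset Printing Implicit Defensive.

Local Open Scope classical_set_scope.
Local Open Scope card_scope.

(** * Infima and suprema of cardinals

    The library compares cardinals ([#<=], [#=]) but has no type of cardinals.
    A cardinal is therefore represented by a set having this cardinal, and is
    well defined only up to [#=]. The infimum (resp. supremum) of
    [{|X| : X in F}] is taken among all cardinals: the sets [L] below range over
    arbitrary types. *)

Definition is_card_inf (T : Type) (F : set (set T)) (K : set T) : Prop :=
  (forall X, F X -> K #<= X) /\
  (forall (S : Type) (L : set S), (forall X, F X -> L #<= X) -> L #<= K).

Definition is_card_sup (T : Type) (F : set (set T)) (K : set T) : Prop :=
  (forall X, F X -> X #<= K) /\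
  (forall (S : Type) (L : set S), (forall X, F X -> X #<= L) -> K #<= L).

(** The default value [set0] is never used when [F] is non-empty, see
    [card_infP] and [card_supP]. *)

Definition card_inf (T : Type) (F : set (set T)) : set T :=
  xget set0 (is_card_inf F).

Definition card_sup (T : Type) (F : set (set T)) : set T :=
  xget set0 (is_card_sup F).

Lemma card_min_exists (T : Type) (F : set (set T)) : F !=set0 ->
  exists2 K, F K & forall X, F X -> K #<= X.
Proof.
move=> [X0 FX0].
pose I := {X : set T | F X}.
pose good (C : set (I -> T)) :=
  (forall f i, C f -> sval i (f i)) /\
  (forall f g i, C f -> C g -> f i = g i -> f = g).
have chain (D : set (set (I -> T))) : D `<=` good -> total_on D subset ->
    good (\bigcup_(C in D) C).
  move=> Dgood totD; split=> [f i [C DC Cf]|f g i [C DC Cf] [C' DC' Cg] fg].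
    exact: (Dgood _ DC).1.
  have [CC'|C'C] := totD _ _ DC DC'.
    by apply: (Dgood _ DC').2 fg => //; exact: CC'.
  by apply: (Dgood _ DC).2 fg => //; exact: C'C.
have [C [Cgood Cmax]] := Zorn_bigcup chain.
have [i Ci] : exists i : I, forall x, sval i x -> exists2 f, C f & f i = x.
  apply: contrapT => /forallNP noi.
  have /choice[h hP] (i : I) : exists x, sval i x /\ forall f, C f -> f i <> x.
    have /existsNP[x /not_implyP[ix nx]] := noi i.
    by exists x; split=> // f Cf fx; apply: nx; exists f.
  have nCh : ~ C h by move=> Ch; exact: (hP (exist _ _ FX0)).2 Ch _.
  apply: (Cmax (h |` C)).
    by split=> [f Cf|/(_ h)]; [right|move=> /(_ (or_introl erefl))].
  split=> [f i [->|Cf]|f g i [->|Cf] [->|Cg] //].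
  - exact: (hP i).1.
  - exact: Cgood.1.
  - by move=> /esym; move: (hP i) => [_ /(_ g Cg)].
  - by move: (hP i) => [_ /(_ f Cf)].
  - exact: Cgood.2.
exists (sval i); first exact: svalP.
move=> X FX; pose j : I := exist _ X FX.
have /choice[e eP] (x : T) :
    exists f, sval i x -> C f /\ f i = x.
  have [ix|nix] := pselect (sval i x); last by exists (fun=> x).
  by have [f Cf fx] := Ci x ix; exists f.
have : $|{injfun sval i >-> X}|.
  apply/injfunPex; exists (fun x => e x j) => [x ix|x y].
    by have := Cgood.1 (e x) j (eP x ix).1.
  rewrite !inE => ix iy exy.
  have /(congr1 (fun f => f i)) : e x = e y.
    by apply: Cgood.2 exy; [exact: (eP x ix).1|exact: (eP y iy).1].
  by rewrite (eP x ix).2 (eP y iy).2.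
by move=> [f]; exact: inj_card_le f.
Qed.

Lemma card_le_total (S T : Type) (A : set S) (B : set T) :
  (A #<= B) \/ (B #<= A).
Proof.
pose A' : set (S + T) := inl @` A; pose B' : set (S + T) := inr @` B.
have AA' : A' #= A by apply: inj_card_eq => x y _ _ [].
have BB' : B' #= B by apply: inj_card_eq => x y _ _ [].
have [|K [->|->] Kmin] := @card_min_exists _ [set A'; B'].
- by exists A'; left.
- left; have := Kmin B' (or_intror erefl).
  by rewrite (card_le_eql AA') (card_le_eqr BB').
- right; have := Kmin A' (or_introl erefl).
  by rewrite (card_le_eql BB') (card_le_eqr AA').
Qed.

Lemma card_infP (T : Type) (F : set (set T)) :
  F !=set0 -> is_card_inf F (card_inf F).
Proof.
move=> /card_min_exists[K FK Kmin].
by apply: (xgetPex set0); exists K; split=> // S L; exact.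
Qed.

Lemma card_supP (T : Type) (F : set (set T)) : is_card_sup F (card_sup F).
Proof.
have [|K Kub Kmin] := @card_min_exists T [set L | forall X, F X -> X #<= L].
  by exists setT => X _; exact: card_leT.
apply: (xgetPex set0); exists K; split=> // S L Lub.
have [//|LK] := card_le_total K L.
have [|M [->|->] Mmin] :=
  @card_min_exists _ [set (inl @` K : set (T + S)); inr @` L].
- by exists (inl @` K); left.
- have := Mmin (inr @` L) (or_intror erefl).
  have KK' : (inl @` K : set (T + S)) #= K by apply: inj_card_eq => x y _ _ [].
  have LL' : (inr @` L : set (T + S)) #= L by apply: inj_card_eq => x y _ _ [].
  by rewrite (card_le_eql KK') (card_le_eqr LL').
have /card_leP[f] := LK.
pose L' : set T := range (fun z : L => set_val (f z)).
have LL' : L' #= L.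
  apply: (@card_eq_trans _ _ _ _ [set: L]); last exact: card_setT.
  apply: inj_card_eq => x y _ _ /val_inj fxy.
  by apply: (inj (f := f)) fxy; rewrite inE.
have /Kmin : forall X, F X -> X #<= L'.
  by move=> X FX; rewrite (card_le_eqr LL'); exact: Lub.
by rewrite (card_le_eqr LL').
Qed.

(** * Right s-factors *)

Section SFactors.
Variable G : groupType.
Implicit Types A U : set G.

Definition direct_product A U : Prop :=
  forall x, [set (a * u)%g | a in A & u in U] x ->
    exists! au : G * G, [/\ A au.1, U au.2 & x = (au.1 * au.2)%g].

Definition SubF_r A : set (set G) :=
  [set U | [/\ U !=set0, direct_product A U &
            forall V : set G, V !=set0 -> direct_product A V ->
              U `<=` V -> V = U]].

(** [lower_index A] and [upper_index A] stand for |G:A|^- and |G:A|^+. *)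

Definition lower_index A : set G := card_inf (SubF_r A).

Definition upper_index A : set G := card_sup (SubF_r A).

Definition stable A : Prop := lower_index A #= upper_index A.

Lemma direct_productP A U : direct_product A U <->
  forall a a' u u', A a -> A a' -> U u -> U u' -> (a * u = a' * u')%g ->
    a = a' /\ u = u'.
Proof.
split=> [AU a a' u u' Aa Aa' Uu Uu' e|AU x [a Aa [u Uu <-]]].
  have [|z [_ zP]] := AU (a * u)%g; first by exists a => //; exists u.
  have := zP (a', u') (And3 Aa' Uu' e).
  by rewrite (zP (a, u) (And3 Aa Uu erefl)) => -[].
exists (a, u); split=> [//|[b v] /= [Ab Vv e]].
by have [-> ->] := AU _ _ _ _ Aa Ab Uu Vv e.
Qed.

Lemma SubF_r_nonempty A : SubF_r A !=set0.
Proof.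
have chain (D : set (set G)) : D `<=` [set U | direct_product A (1%g |` U)] ->
    total_on D subset ->
    direct_product A (1%g |` \bigcup_(U in D) U).
  move=> DP totD; apply/direct_productP => a a' u u' Aa Aa' Uu Uu' e.
  have [U [DU Uu2 Uu2']] : exists U, [/\ D U \/ U = set0,
      (1%g |` U) u & (1%g |` U) u'].
    case: Uu Uu' => [->|[U DU Uu]] [->|[V DV Vu]].
    - by exists set0; split; [right|left|left].
    - by exists V; split; [left|left|right].
    - by exists U; split; [left|right|left].
    - have [UV|VU] := totD _ _ DU DV.
        by exists V; split; [left|right; exact: UV|right].
      by exists U; split; [left|right|right; exact: VU].
  case: DU => [/DP /direct_productP H|U0]; first exact: H e.
  move: Uu2 Uu2' e; rewrite U0 => -[->|//] [->|//].
  by move/mulIg.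
have [U [UP Umax]] := Zorn_bigcup chain.
exists (1%g |` U); split=> [||V V0 AV UV].
- by exists 1%g; left.
- exact: UP.
apply: contrapT => VU.
have V1 : 1%g |` V = V.
  by apply/seteqP; split=> [x [->|//]|x]; [apply: UV; left|right].
apply: (Umax V); last by rewrite /= V1.
split=> [x Ux|VsubU]; first by apply: UV; right.
by apply: VU; apply/seteqP; split=> [x /VsubU|//]; right.
Qed.

End SFactors.

Definition stable_group (G : groupType) : Prop :=
  forall A : set G, A !=set0 -> stable A.

Definition unstable_group (G : groupType) : Prop := ~ stable_group G.

(* Main.v *)
Require Import Defs.
From mathcomp Require Import all_boot.
From mathcomp Require Import boolp classical_sets functions cardinality.
From mathcomp Require wochoice.

Set Implicit Arguments.
Unset Strict Implicit.
Unset Printing Implicit Defensive.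

Local Open Scope classical_set_scope.

(** Since [a u = a' u'] iff [a'^-1 a = u' u^-1], the product [A U] is direct iff
    no quotient [u v^-1] of distinct elements of [U] lies in [A^-1 A]. The
    right s-factors of [A] are thus the maximal cliques of the Cayley graph in
    which [u] and [v] are joined when [u v^-1] is outside [A^-1 A], and it
    suffices to find [A] for which this graph has two maximal cliques of
    different cardinals.

    - Every finite symmetric set not containing 1 is the complement of some
      [A^-1 A] ([difference_set]). Enlarge [A] by pairs [x], [x t], one for
      each quotient [t] to be realised; only the [x] in a finite union of
      translates of what was chosen before are forbidden. A transfinite
      enumeration for which such forbidden sets never exhaust the group is
      provided by [small_enumeration].

    - Let [E] have 5 elements, let [Q] be the set of the nontrivial quotients
      [e f^-1] of elements of [E], and let [k] be outside [{1}] and [Q Q].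
      For the graph defined by [Q] together with [k] and [k^-1], the set [E] is
      a clique, but a clique containing 1 and [k] is included in
      [{1, k, k^-1, k^2}]: any further [x] would have [x] and [x k^-1] in [Q],
      which puts [k] in [Q Q]. Maximal cliques extending [E] and [{1, k}]
      ([SubF_r_extend]) therefore have at least 5 and at most 4 elements. *)

(** * Transfinite choice *)

Section TransfiniteChoice.
Variables (I : Type) (lt : I -> I -> Prop).
Hypothesis lt_wf : well_founded lt.

Definition restrict_below {T : Type} (t0 : T) (i : I) (B : I -> T) : I -> T :=
  fun j => if pselect (lt j i) is left _ then B j else t0.

(** The default value [t0] replaces the values that are not yet known at stage
    [i], so that [P] can be stated for total functions. *)
Lemma transfinite_choice (T : Type) (t0 : T) (P : I -> (I -> T) -> T -> Prop) :
  (forall i B, exists b, P i B b) ->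
  exists B, forall i, P i (restrict_below t0 i B) (B i).
Proof.
move=> ex_b.
have /choice[c cP] (iB : I * (I -> T)) : exists b, P iB.1 iB.2 b by exact: ex_b.
pose F i (rec : forall j, lt j i -> T) :=
  c (i, fun j => if pselect (lt j i) is left h then rec j h else t0).
exists (Fix lt_wf (fun=> T) F) => i.
rewrite (Fix_eq lt_wf (fun=> T) F); first exact: (cP (i, restrict_below t0 i _)).
move=> j f g fg; congr (c (_, _)); apply/funext => m.
by case: pselect => // h; exact: fg.
Qed.

End TransfiniteChoice.

(** * Small sets *)

Section Small.
Variable T : choiceType.
Implicit Types (S : set T) (g : T -> seq T).

Definition covers S g := forall x, exists2 s, S s & x \in g s.

(** For infinite [T] and [S] this says that the cardinal of [S] is less than that
    of [T]. Phrased with covers by finite sets, it treats a countable [T], whose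
    small sets are the finite ones, like any other, and it is literally what a
    stage of the transfinite construction needs. *)
Definition small S := forall g, ~ covers S g.

Lemma infinite_notin (s : seq T) : infinite_set [set: T] -> exists x, x \notin s.
Proof.
move=> Tinf; apply: contrapT => /forallNP sT; apply: Tinf.
apply: (sub_finite_set _ (finite_seq s)) => x _ /=.
by apply: contrapT => /negP; exact: sT.
Qed.

Lemma small_avoid S g (b : seq T) : infinite_set [set: T] -> small S ->
  exists x, x \notin b /\ forall s, S s -> x \notin g s.
Proof.
move=> Tinf smallS; apply: contrapT => /forallNP bad.
have [[s0 Ss0]|S0] := pselect (S !=set0).
  (* A nonempty index set absorbs the extra finite set [b]. *)
  apply: (smallS (fun s => g s ++ b)) => x.
  have [xb|xb] := boolP (x \in b); first by exists s0; rewrite ?mem_cat ?xb ?orbT.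
  apply: contrapT => /forall2NP noS; apply: (bad x); split=> // s Ss.
  have [//|/negP] := noS s; rewrite mem_cat negb_or.
  by case/andP.
have [x xb] := infinite_notin b Tinf.
by apply: (bad x); split=> // s Ss; case: S0; exists s.
Qed.

(** Take a well-order of [T]. If all its proper initial segments are small, the
    enumeration by singletons is suitable. Otherwise there is a least segment
    that is not small: it indexes a cover of [T] by finite sets, and its own
    proper initial segments are small. *)
Lemma small_enumeration : exists (lt : T -> T -> Prop) g,
  [/\ well_founded lt,
      forall i j, [\/ lt i j, i = j | lt j i],
      forall i, g i = [::] \/ small [set j | lt j i] &
      covers setT g].
Proof.
have [R Rwo] := wochoice.well_ordering_principle T.
have Rmin (A : set T) : A !=set0 -> exists2 z, A z & forall x, A x -> R z x.
  move=> [x Ax]; have [|z [[Az zmin] _]] := Rwo (fun x => `[< A x >]).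
    by exists x; apply/asboolP.
  exists z; first exact/asboolP.
  by move=> y Ay; apply: zmin; exact/asboolP.
have Rtot x y : R x y \/ R y x.
  have [|z [->|->] zmin] := Rmin [set x; y]; first by exists x; left.
  - by left; apply: zmin; right.
  - by right; apply: zmin; left.
have Ranti x y : R x y -> R y x -> x = y.
  move=> xy yx.
  have Rxx u : R u u by have [] := Rtot u u.
  have [|z [_ zuniq]] := Rwo (mem [:: x; y]); first by exists x; rewrite mem_head.
  rewrite -(zuniq x) ?(zuniq y) //; split; rewrite ?inE ?eqxx ?orbT // => u.
  - by rewrite !inE => /orP[]/eqP->.
  - by rewrite !inE => /orP[]/eqP->.
pose lt x y := R x y /\ x <> y.
have lt_tri x y : [\/ lt x y, x = y | lt y x].
  have [->|/eqP xy] := eqVneq x y; first exact: Or32.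
  have [Rxy|Ryx] := Rtot x y; first exact: Or31.
  by apply: Or33; split=> // /esym.
have lt_wf : well_founded lt.
  move=> x; apply: contrapT => nx.
  have [|z nz zmin] := Rmin [set x | ~ Acc lt x]; first by exists x.
  apply: nz; constructor=> y [Ryz yz].
  by apply: contrapT => ny; apply: yz; apply: Ranti => //; exact: zmin.
have [all_small|] := pselect (forall i, small [set j | lt j i]).
  exists lt, (fun x => [:: x]); split=> // [i|x]; first by right.
  by exists x; rewrite ?mem_head.
move=> /existsNP nsmall.
have [d dns dmin] := Rmin [set i | ~ small [set j | lt j i]] nsmall.
have [g cov] : exists g, covers [set j | lt j d] g.
  by apply: contrapT => /forallNP.
exists lt, (fun i => if pselect (lt i d) then g i else [::]); split=> // [i|x].
- case: pselect => [[Rid id']|]; last by left.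
  right; apply: contrapT => nsi; apply: id'.
  by apply: Ranti => //; exact: dmin.
- by have [s /= sd xs] := cov x; exists s => //; case: pselect.
Qed.

End Small.

(** * Prescribing the set of left quotients *)

Section DifferenceSet.
Variable G : groupType.
Hypothesis Ginf : infinite_set [set: G].
Variable l : seq G.
Hypotheses (l1 : 1%g \notin l) (lV : forall x, x \in l -> (x^-1)%g \in l).
Local Open Scope group_scope.

Let lVN x : x \notin l -> x^-1 \notin l.
Proof. by apply: contra => /lV; rewrite invgK. Qed.

(** One stage of the construction. The family [B] gives the elements chosen at
    the stages in [S], [ts] the quotients to be realised by the new ones. The
    pairs [x], [x t] are added one quotient after the other; [small_avoid] allows
    for the finitely many elements already added at this stage. *)
Lemma difference_set_step (S : set G) (B : G -> seq G) (ts : seq G) : small S ->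
  exists b : seq G,
  [/\ forall t, t \in ts -> t \notin l -> exists2 x, x \in b & x * t \in b,
      forall s z y, S s -> z \in B s -> y \in b -> z^-1 * y \notin l &
      forall z y, z \in b -> y \in b -> z^-1 * y \notin l].
Proof.
move=> smallS; elim: ts => [|t ts [b [b_ts Bb bb]]]; first by exists [::].
have [tl|tl] := boolP (t \in l).
  exists b; split=> // u; rewrite inE => /orP[/eqP->|]; last exact: b_ts.
  by rewrite tl.
(* The [x] for which [z^-1 x] or [z^-1 (x t)] is in [l] for some [z] in [s]. *)
pose bad (s : seq G) :=
  [seq z * c | z <- s, c <- l] ++ [seq z * c * t^-1 | z <- s, c <- l].
have badP s x z : x \notin bad s -> z \in s ->
    (z^-1 * x \notin l) /\ (z^-1 * (x * t) \notin l).
  rewrite mem_cat negb_or => /andP[x1 x2] zs; split.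
  - apply: contra x1 => zxl; apply/allpairsP; exists (z, z^-1 * x) => /=.
    by rewrite mulVKg.
  - apply: contra x2 => zxl; apply/allpairsP; exists (z, z^-1 * (x * t)) => /=.
    by rewrite mulVKg mulgK.
have [x [xb xB]] := small_avoid (fun s => bad (B s)) (bad b) Ginf smallS.
exists (x :: x * t :: b); split.
- move=> u; rewrite inE => /orP[/eqP-> _|uts ul].
    by exists x; rewrite !inE ?eqxx ?orbT.
  have [y yb yub] := b_ts u uts ul.
  by exists y; rewrite !inE (yb, yub) !orbT.
- move=> s z y Ss zBs; have [zx zxt] := badP _ _ _ (xB s Ss) zBs.
  by rewrite !inE => /or3P[/eqP->|/eqP->|] //; exact: Bb Ss zBs.
- have xx u : u^-1 * u \notin l by rewrite mulVg.
  have xt : x^-1 * (x * t) \notin l by rewrite mulKg.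
  have sym u v : u^-1 * v \notin l -> v^-1 * u \notin l.
    by move/lVN; rewrite invgM invgK.
  move=> z y; rewrite !inE.
  move=> /or3P[/eqP->|/eqP->|zb] /or3P[/eqP->|/eqP->|yb] //.
  + by apply: sym; have [] := badP _ _ _ xb yb.
  + exact: sym.
  + by apply: sym; have [] := badP _ _ _ xb yb.
  + by have [] := badP _ _ _ xb zb.
  + by have [] := badP _ _ _ xb zb.
  + exact: bb.
Qed.

(** The quotients of [small_enumeration] that are outside [l] are realised stage
    by stage. By the symmetry of [l] it is enough that each new element respects
    the earlier ones. *)
Lemma difference_set : exists2 A : set G, A !=set0 &
  forall x, (exists a b, [/\ A a, A b & a^-1 * b = x]) <-> x \notin l.
Proof.
have [lt [g [lt_wf lt_tri g_small g_cov]]] := small_enumeration G.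
have step i (B : G -> seq G) : exists b : seq G,
  [/\ forall t, t \in g i -> t \notin l -> exists2 x, x \in b & x * t \in b,
      forall s z y, lt s i -> z \in B s -> y \in b -> z^-1 * y \notin l &
      forall z y, z \in b -> y \in b -> z^-1 * y \notin l].
  have [->|small_i] := g_small i; first by exists [::].
  exact: (@difference_set_step [set j | lt j i]).
have [B BP] := transfinite_choice lt_wf [::] step.
have B_lt s i z y : lt s i -> z \in B s -> y \in B i -> z^-1 * y \notin l.
  move=> si zs; have [_ Bi _] := BP i; apply: (Bi _ _ _ si).
  by rewrite /restrict_below; case: pselect.
pose A : set G := [set x | exists i, x \in B i].
have A_real t : t \notin l -> exists a b, [/\ A a, A b & a^-1 * b = t].
  move=> tl; have [i _ ti] := g_cov t; have [/(_ t ti tl)[x xi xti] _ _] := BP i.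
  by exists x, (x * t); split; [exists i|exists i|rewrite mulKg].
exists A; first by have [a [_ [Aa _ _]]] := A_real _ l1; exists a.
move=> x; split=> [[a [b [[i ai] [j bj] <-]]]|]; last exact: A_real.
have [ij|ij|ji] := lt_tri i j.
- exact: B_lt ij ai bj.
- by have [_ _ Bi] := BP j; apply: Bi bj; rewrite -ij.
- by rewrite -[b]invgK -invgM lVN ?(B_lt j i).
Qed.

End DifferenceSet.

(** * Right s-factors as maximal cliques *)

Lemma SubF_r_extend (G : groupType) (A V : set G) :
  V !=set0 -> direct_product A V -> exists2 U, SubF_r A U & V `<=` U.
Proof.
move=> [v Vv] AV.
(* Zorn's lemma also considers the empty chain, whose union is empty: hence the
   sets to be added to [V], instead of the sets containing it. *)
have dir_bigcup (D : set (set G)) :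
    D `<=` [set W | direct_product A (V `|` W)] -> total_on D subset ->
    direct_product A (V `|` \bigcup_(W in D) W).
  move=> DP totD; apply/direct_productP => a a' u u' Aa Aa' Uu Uu' e.
  have [W [AW Wu Wu']] : exists W, [/\ direct_product A (V `|` W),
      (V `|` W) u & (V `|` W) u'].
    case: Uu Uu' => [Vu|[W DW Wu]] [Vu'|[W' DW' Wu']].
    - by exists set0; rewrite setU0.
    - by exists W'; split; [exact: DP|left|right].
    - by exists W; split; [exact: DP|right|left].
    - have [WW'|W'W] := totD _ _ DW DW'.
        by exists W'; split; [exact: DP|right; exact: WW'|right].
      by exists W; split; [exact: DP|right|right; exact: W'W].
  by move/direct_productP: AW => /(_ _ _ _ _ Aa Aa' Wu Wu' e).
have [W [AW Wmax]] := Zorn_bigcup dir_bigcup.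
exists (V `|` W); last exact: subsetUl.
split=> // [|X X0 AX sub]; first by exists v; left.
apply: contrapT => neq.
have VX : V `|` X = X by apply/setUidPr => x Vx; apply: sub; left.
apply: (Wmax X); last by rewrite /= VX.
split=> [x Wx|XW]; first by apply: sub; right.
by apply: neq; apply/seteqP; split=> [x /XW|//]; right.
Qed.

Lemma direct_product_clique (G : groupType) (l : seq G) (A U : set G) :
  (forall x, (exists a b, [/\ A a, A b & (a^-1 * b)%g = x]) <-> x \notin l) ->
  direct_product A U <->
    forall u v, U u -> U v -> u <> v -> (u * v^-1)%g \in l.
Proof.
move=> AP; split=> [/direct_productP AU u v Uu Uv uv|cl].
  apply/negP => /negP/AP[a [b [Aa Ab e]]]; apply: uv.
  have [] // := AU b a v u Ab Aa Uv Uu.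
  by rewrite -[b](mulVKg a) e -mulgA mulgVK.
apply/direct_productP => a a' u u' Aa Aa' Uu Uu' e.
have [uu'|/eqP uu'] := eqVneq u u'.
  by split=> //; apply: (mulIg u); rewrite e uu'.
have eq : (a'^-1 * a = u' * u^-1)%g.
  by rewrite -(mulgK u a) e mulgA mulKg.
have : (u' * u^-1)%g \notin l by apply/AP; exists a', a.
by rewrite cl // => /esym.
Qed.

(** * Two maximal cliques of different sizes *)

Lemma card_le_seq (T : eqType) (s : seq T) (U : set T) :
  U `<=` [set` s] -> (U #<= `I_(size s))%card.
Proof.
move=> Us.
have : $|{injfun U >-> `I_(size s)}|.
  apply/injfunPex; exists (index^~ s) => [x /Us|x y]; first by rewrite /= index_mem.
  rewrite !inE => /Us xs /Us ys e.
  by rewrite -(nth_index x xs) e nth_index.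
by move=> [f]; exact: inj_card_le f.
Qed.

Lemma SubF_r_card_le (G : groupType) (A U V : set G) :
  stable A -> SubF_r A U -> SubF_r A V -> (V #<= U)%card.
Proof.
move=> stA AU AV.
have [inf_le _] := card_infP (SubF_r_nonempty A).
have [le_sup _] := card_supP (SubF_r A).
apply: card_le_trans (le_sup V AV) _.
rewrite -(card_le_eql stA); exact: inf_le.
Qed.

Theorem mainTheorem1 (G : groupType) (Ginf : infinite_set [set: G]) :
  unstable_group G.
Proof.
move=> stG.
have [f f_inj] : exists f : nat -> G, injective f.
  have /infiniteP/card_leP[f] := Ginf.
  exists (fun n => set_val (f (to_setT n))) => i j /val_inj.
  by move/(inj (f := f)); rewrite !inE => /(_ I I)/(congr1 set_val).
(* Five elements, to exceed the bound 4 on the cliques containing 1 and [k]. *)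
pose Q := [seq x <- [seq (f i * (f j)^-1)%g | i <- iota 0 5, j <- iota 0 5]
             | x != 1%g].
have QE i j : (i < 5)%N -> (j < 5)%N -> f i <> f j -> (f i * (f j)^-1)%g \in Q.
  move=> i5 j5 fij; rewrite mem_filter; apply/andP; split.
    by apply/eqP => /divg1_eq.
  by apply/allpairsP; exists (i, j); split; rewrite ?mem_iota.
have QV x : x \in Q -> (x^-1)%g \in Q.
  rewrite !mem_filter invg_eq1 => /andP[-> /allpairsP[[i j] [i5 j5 ->]]].
  by apply/allpairsP; exists (j, i); split; rewrite // invgM invgK.
have Q1 : 1%g \notin Q by rewrite mem_filter eqxx.
have [k] := infinite_notin (1%g :: [seq (p * q)%g | p <- Q, q <- Q]) Ginf.
rewrite inE negb_or => /andP[k1 kQQ].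
pose l := (k :: (k^-1)%g :: Q).
have l1 : 1%g \notin l.
  by rewrite !inE !negb_or Q1 eq_sym k1 eq_sym invg_eq1 k1.
have lV x : x \in l -> (x^-1)%g \in l.
  by rewrite !inE => /or3P[/eqP->|/eqP->|/QV->]; rewrite ?invgK ?eqxx ?orbT.
have [A A0 AP] := difference_set Ginf l1 lV.
have dirP U := direct_product_clique U AP.
have [||U AU EU] := @SubF_r_extend _ A (f @` `I_5).
- by exists (f 0%N); exists 0%N.
- apply: (dirP _).2 => _ _ [i i5 <-] [j j5 <-] fij.
  by rewrite !inE QE ?orbT.
have [||V AV kV] := @SubF_r_extend _ A [set 1%g; k].
- by exists 1%g; left.
- apply: (dirP _).2 => u v [->|->] [->|->] // _; rewrite !inE.
  + by rewrite mul1g eqxx orbT.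
  + by rewrite invg1 mulg1 eqxx.
have Vsub : V `<=` [set` [:: 1; k; k^-1; k * k]]%g.
  move=> x Vx; rewrite /= !inE.
  have [//|/eqP x1] := eqVneq x 1%g; have [//|/eqP xk] := eqVneq x k.
  have [_ /dirP clV _] := AV.
  have /= := clV x 1%g Vx (kV _ (or_introl erefl)) x1.
  rewrite invg1 mulg1 !inE => /or3P[/eqP//|->//|xQ].
  have := clV x k Vx (kV _ (or_intror erefl)) xk.
  rewrite !inE => /or3P[/eqP xkk|/eqP xkk|xkQ].
  - by rewrite -[x](mulgVK k) xkk eqxx !orbT.
  - by case: x1; rewrite -[x](mulgVK k) xkk mulVg.
  (* Here [x] and [x k^-1] are both in [Q], and so is [k = (x k^-1)^-1 x] in [Q Q]. *)
  - case/negP: kQQ; apply/allpairsP; exists ((x * k^-1)^-1, x)%g => /=.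
    by rewrite (QV _ xkQ) xQ invgM invgK mulgVK.
have := SubF_r_card_le (stG A A0) AV AU.
have I5U : (`I_5 #<= U)%card.
  by rewrite -(card_le_eql (inj_card_eq (in2W f_inj))); exact: subset_card_le.
move=> /(card_le_trans I5U)/card_le_trans /(_ (card_le_seq Vsub)).
by rewrite card_le_II.
Qed.
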